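(* Let $i \geq 3$ be an integer. Suppose $S=S(\lambda_1, \dots, \lambda_d)$ is an $n$-vertex spider with $(\lambda_1, \dots, \lambda_d)$ a partition, where $i<d$, $\lambda_i \geq 2$, $\lambda_i \leq \lambda_{i+1} + \dots + \lambda_d$, and $\lambda_j > \lambda_{j+1} + \dots + \lambda_d$ for all $j < i$. Let $n = q(\lambda_i + 1) + r$ where $0\leq r <\lambda _i +1$, and $r = qd' + r'$ where $0\leq r' <q$ (with $q,r,d',r'$ nonnegative integers). Then $S$ is missing a connected partition of type $$(\lambda_i + d' + 2)^{r'} (\lambda_i + d' + 1)^{q - r'}.$$
   Context: Given a partition $\lambda=(\lambda_1\ge\cdots\ge\lambda_d>0)$ of $n-1$ with $d\ge 3$ parts, the spider $S(\lambda_1,\ldots,\lambda_d)$ is the $n$-vertex tree consisting of $d$ disjoint paths $P_{\lambda_1},\ldots,P_{\lambda_d}$ (the legs), where $P_k$ denotes the path with $k$ vertices, together with one further vertex (the centre) joined to one end vertex of each path. A connected partition of an $n$-vertex graph $G$ is a partitioning of its vertex set into $\{V_1,\ldots,V_k\}$ such that the subgraph induced by each $V_j$ is connected; its type is the partition of $n$ obtained by sorting the sizes $|V_j|$ in decreasing order. $G$ is missing a connected partition of type $\mu$ if no connected partition of $G$ has type $\mu$. The notation $a^{r'}b^{q-r'}$ denotes the partition with $r'$ parts equal to $a$ and $q-r'$ parts equal to $b$. *)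

(* Defs.v *)
From HB Require Import structures.
From mathcomp Require Import all_boot.

Set Implicit Arguments.
Unset Strict Implicit.
Unset Printing Implicit Defensive.

(* A graph on T : finType is given by its adjacency relation. *)

Definition intpart (m : nat) (lam : seq nat) : bool :=
  [&& sorted geq lam, all (fun k => 0 < k) lam & sumn lam == m].

(* Parts are numbered from 1; part lam 0 is never used, and part lam j = 0 for
   j > size lam. *)
Definition part (lam : seq nat) (j : nat) : nat := nth 0 lam j.-1.

(* lam_(j+1) + ... + lam_d, where d = size lam *)
Definition tail_sum (lam : seq nat) (j : nat) : nat :=
  \sum_(j.+1 <= k < (size lam).+1) part lam k.

(* None is the centre; Some (j; a) is the vertex at distance a + 1 from the
   centre on the leg with part lam j.+1 vertices. *)
Definition spider_vertex (lam : seq nat) : finType :=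
  option {j : 'I_(size lam) & 'I_(part lam j.+1)}.

(* The edges, oriented away from the centre. *)
Definition spider_arc (lam : seq nat) (u v : spider_vertex lam) : bool :=
  match u, v with
  | None, Some w => tagged w == 0 :> nat
  | Some w, Some w' =>
      (tag w == tag w') && ((tagged w).+1 == tagged w' :> nat)
  | _, None => false
  end.

Definition spider (lam : seq nat) : rel (spider_vertex lam) :=
  [rel u v | spider_arc u v || spider_arc v u].

Definition induced (T : finType) (e : rel T) (B : {set T}) : rel T :=
  [rel x y | [&& x \in B, y \in B & e x y]].

Definition connected_in (T : finType) (e : rel T) (B : {set T}) : bool :=
  [forall x in B, forall y in B, connect (induced e B) x y].

Definition connected_partition (T : finType) (e : rel T)
    (P : {set {set T}}) : bool :=
  partition P [set: T] && [forall B in P, connected_in e B].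

Definition partition_type (T : finType) (P : {set {set T}}) : seq nat :=
  sort geq [seq #|B| | B : {set T} <- enum P].

Definition missing (T : finType) (e : rel T) (mu : seq nat) : Prop :=
  ~ exists P : {set {set T}},
      connected_partition e P /\ partition_type P = mu.

Lemma spider_sym (lam : seq nat) : symmetric (@spider lam).
Proof. by move=> u v; rewrite /spider /= orbC. Qed.

Lemma spider_irr (lam : seq nat) : irreflexive (@spider lam).
Proof.
by case=> [w|] //; rewrite /spider /= (gtn_eqF (ltnSn _)) andbF.
Qed.

Lemma card_spider (lam : seq nat) : #|spider_vertex lam| = (sumn lam).+1.
Proof.
rewrite card_option card_tagged -[in RHS](mkseq_nth 0 lam) /mkseq -val_enum_ord.
rewrite -map_comp; congr (sumn _).+1.
by apply: eq_map => j; rewrite /= card_ord.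
Qed.

(* Main.v *)
Require Import Defs.
From HB Require Import structures.
From mathcomp Require Import all_boot.
From mathcomp Require Import zify.

(** Write L for the i-th part of lam.  Every block of a partition of the given
    type has at least L + d' + 1 > L vertices.  A connected set avoiding the
    centre of a spider lies inside one leg, so a leg with at most L vertices
    meets no block that avoids the centre: the block of the centre contains it
    ([short_leg_sub_centre_block]).  The legs i, ..., d all have at most L
    vertices, so the block of the centre has at least
    1 + L + tail_sum lam i >= 1 + 2 L vertices ([centre_block_large]).  As it
    has at most L + d' + 2 vertices, d' >= L - 1.

    On the other hand the legs 1, 2 and i have at least L vertices each and the
    later legs have at least L together, so n >= 4 L + 1 >= 3 (L + 1) and
    q >= 3.  Then 3 (L - 1) <= q d' <= r <= L forces L <= 1, against L >= 2. *)

Set Implicit Arguments.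
Unset Strict Implicit.
Unset Printing Implicit Defensive.

Lemma tail_sum_recl (lam : seq nat) (j : nat) :
  j < size lam -> tail_sum lam j = part lam j.+1 + tail_sum lam j.+1.
Proof. by move=> ltj; rewrite /tail_sum big_ltn. Qed.

Lemma tail_sum0 (lam : seq nat) : tail_sum lam 0 = sumn lam.
Proof. by rewrite /tail_sum big_add1 sumnE [RHS](big_nth 0). Qed.

Lemma tail_sum_anti (lam : seq nat) (j k : nat) :
  j <= k -> tail_sum lam k <= tail_sum lam j.
Proof.
move=> lejk; rewrite /tail_sum.
have [lekd|ltdk] := leqP k (size lam); last by rewrite big_geq ?ltnS ?(ltnW ltdk).
by rewrite [leqRHS](big_cat_nat (n := k.+1)) ?leq_addl ?ltnS.
Qed.

Lemma part_anti (lam : seq nat) (j k : nat) :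
  sorted geq lam -> j <= k -> part lam k <= part lam j.
Proof.
move=> lam_sorted lejk; rewrite /part.
have [ltkd|ledk] := ltnP k.-1 (size lam); last by rewrite nth_default.
have geq_trans : transitive geq by move=> y x z /= xy yz; exact: leq_trans xy.
apply: (sorted_leq_nth geq_trans leqnn 0 lam_sorted); rewrite ?inE; lia.
Qed.

(** Two adjacent vertices other than the centre are on the same leg, so a walk
    that avoids the centre never changes legs. *)
Lemma connected_leg (lam : seq nat) (B : {set spider_vertex lam}) w w' :
  connected_in (@spider lam) B -> None \notin B ->
  Some w \in B -> Some w' \in B -> tag w = tag w'.
Proof.
move=> /forall_inP/(_ (Some w)) conB NB wB w'B.
have /forall_inP/(_ _ w'B)/connectP[p pth lst] := conB wB.
elim: p w wB pth lst {conB} => [|u p IHp] w wB /=; first by move=> _ [->].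
case: u => [u|] /andP[/and3P[_ uB wu] pth] lst; last by rewrite uB in NB.
rewrite -(IHp u uB pth lst); move: wu; rewrite /spider /=.
by case/orP=> /andP[/eqP].
Qed.

Lemma card_legs (lam : seq nat) (A : pred 'I_(size lam)) :
  #|[set u : spider_vertex lam | if u is Some w then A (tag w) else false]|
  = \sum_(j | A j) part lam j.+1.
Proof.
set legs := [set u | _].
have -> : legs = Some @: [set w | A (tag w)].
  apply/setP => -[w|]; rewrite inE.
    by rewrite mem_imset ?inE; last exact: Some_inj.
  by apply/esym/negbTE/imsetP => -[].
rewrite card_imset; last exact: Some_inj.
rewrite -sum1_card.
transitivity (\sum_(j | A j) \sum_(a : 'I_(part lam j.+1)) 1).
  by rewrite sig_big_dep; apply: eq_bigl => w; rewrite inE andbT.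
by apply: eq_bigr => j _; rewrite sum1_card card_ord.
Qed.

Lemma card_connected_leg (lam : seq nat) (B : {set spider_vertex lam}) w :
  connected_in (@spider lam) B -> None \notin B -> Some w \in B ->
  #|B| <= part lam (tag w).+1.
Proof.
move=> conB NB wB.
rewrite -(big_pred1_eq addn (tag w) (fun j => part lam j.+1)) -card_legs.
apply/subset_leq_card/subsetP => -[w'|] uB; last by rewrite uB in NB.
by rewrite inE /= (connected_leg conB NB wB uB).
Qed.

(** Otherwise the block of a vertex of the leg would avoid the centre, hence
    fit inside that leg, which has too few vertices. *)
Lemma short_leg_sub_centre_block (lam : seq nat)
    (P : {set {set spider_vertex lam}})
    (w : {j : 'I_(size lam) & 'I_(part lam j.+1)}) :
  connected_partition (@spider lam) P ->
  (forall B, B \in P -> part lam (tag w).+1 < #|B|) ->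
  Some w \in pblock P None.
Proof.
move=> /andP[/and3P[/eqP covP trivP _] /forall_inP conP] bigP.
have inP u : u \in cover P by rewrite covP inE.
have wP := pblock_mem (inP (Some w)).
have wB : Some w \in pblock P (Some w) by rewrite mem_pblock.
suff NB : None \in pblock P (Some w) by rewrite (def_pblock trivP wP NB).
apply: contraLR (bigP _ wP) => NB; rewrite -leqNgt.
exact: card_connected_leg (conP _ wP) NB wB.
Qed.

(** The legs after the j-th have at most [part lam j.+1] vertices, as the parts
    decrease, so the block of the centre contains all of them. *)
Lemma centre_block_large (lam : seq nat)
    (P : {set {set spider_vertex lam}}) (j : nat) :
  sorted geq lam -> connected_partition (@spider lam) P ->
  (forall B, B \in P -> part lam j.+1 < #|B|) ->
  tail_sum lam j < #|pblock P None|.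
Proof.
move=> lam_sorted conP bigP.
have -> : tail_sum lam j = \sum_(k < size lam | j <= k) part lam k.+1.
  by rewrite /tail_sum big_add1 big_geq_mkord.
rewrite -card_legs; apply/proper_card/properP; split.
  apply/subsetP => -[w|]; rewrite inE // => lejw.
  apply: short_leg_sub_centre_block => // B /bigP; apply: leq_ltn_trans.
  exact: part_anti.
exists None; last by rewrite inE.
by case/andP: conP => /and3P[/eqP covP _ _] _; rewrite mem_pblock covP inE.
Qed.

Theorem lemma28 (i n d : nat) (lam : seq nat) (q r d' r' : nat)
    (hi : 3 <= i)
    (hlam : intpart n.-1 lam)
    (hd : size lam = d)
    (hd3 : 3 <= d)
    (hid : i < d)
    (hi2 : 2 <= part lam i)
    (hile : part lam i <= tail_sum lam i)
    (hgt : forall j, 1 <= j -> j < i -> part lam j > tail_sum lam j)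
    (hn : n = q * (part lam i + 1) + r)
    (hr : r < part lam i + 1)
    (hr' : r = q * d' + r')
    (hr'q : r' < q) :
  missing (@spider lam)
    (nseq r' (part lam i + d' + 2) ++ nseq (q - r') (part lam i + d' + 1)).
Proof.
move=> [P [conP typeP]].
have [lam_sorted _ /eqP sum_lam] := and3P hlam.
have sizeB B : B \in P -> part lam i + d' + 1 <= #|B| <= part lam i + d' + 2.
  move=> BP; have : #|B| \in partition_type P.
    by rewrite mem_sort; apply: map_f; rewrite mem_enum.
  by rewrite typeP mem_cat !mem_nseq => /orP[]/andP[_ /eqP->]; lia.
have tail_i : tail_sum lam i.-1 = part lam i + tail_sum lam i.
  by rewrite tail_sum_recl ?prednK //; lia.
have centreP : pblock P None \in P.
  by case/andP: conP => /and3P[/eqP covP _ _] _; rewrite pblock_mem ?covP ?inE.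
have d'_ge : part lam i <= d' + 1.
  have bigP B : B \in P -> part lam i.-1.+1 < #|B|.
    by move=> /sizeB; rewrite prednK; lia.
  have := centre_block_large lam_sorted conP bigP.
  by have := sizeB _ centreP; lia.
have q_ge3 : 3 <= q.
  have n_ge : part lam i + part lam i + (part lam i + tail_sum lam i) <= n.-1.
    rewrite -sum_lam -tail_sum0 (@tail_sum_recl _ 0) ?(@tail_sum_recl _ 1);
      try lia.
    rewrite [leqRHS]addnA -tail_i; apply: leq_add; last by apply: tail_sum_anti; lia.
    by apply: leq_add; apply: part_anti => //; lia.
  rewrite leqNgt; apply/negP => q_le2.
  have : q * (part lam i + 1) <= 2 * (part lam i + 1) by rewrite leq_mul.
  by lia.
have : 3 * d' <= q * d' by rewrite leq_mul2r q_ge3 orbT.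
by lia.
Qed.
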